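(* Let $N\ge1$, let $\Omega\subset\mathbb{R}^N$ be any smooth bounded domain, let $q>1$ and $T\in(0,\infty]$. Let $u\in C(\overline\Omega\times(0,T))\cap C^{2,1}(Q_{\Omega,T})$ be a nonnegative solution of $$u_t-\Delta u+|\nabla u|^q=0\quad\text{in }Q_{\Omega,T}=\Omega\times(0,T),$$ bounded on $\partial\Omega\times(0,T)$. Then there is a constant $C=C(N,q,\Omega)$ such that for any $t\in(0,T)$ and any $x\in\Omega$, $$u(x,t)\le C\big(1+t^{-\frac1{q-1}}\big)\,d(x,\partial\Omega)+\sup_{\partial\Omega\times(0,T)}u .$$
   Context: $d(x,\partial\Omega)$ is the distance from $x$ to $\partial\Omega$. $C^{2,1}(Q_{\Omega,T})$ means $u,u_t,\nabla u,D^2u$ are continuous in $Q_{\Omega,T}$. $C=C(N,q,\Omega)$ means that $C$ depends only on $N,q,\Omega$. *)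

(* Defs.v *)
From mathcomp Require Import all_boot all_order all_algebra.
From mathcomp Require Import all_classical all_reals all_analysis.
Set Implicit Arguments.
Unset Strict Implicit.
Unset Printing Implicit Defensive.
Import Order.TTheory GRing.Theory Num.Theory.
Import numFieldNormedType.Exports.
Local Open Scope classical_set_scope.
Local Open Scope ring_scope.

Section Geometry.
Context {R : realType} {N : nat}.
Implicit Types (x y : 'rV[R]_N) (A Omega : set 'rV[R]_N).

(* The library norm `|x| on 'rV[R]_N is the sup norm; it induces the usual
   topology and bounded sets, but Euclidean lengths need their own definition. *)
Definition enorm x : R := Num.sqrt (\sum_i x 0 i ^+ 2).

Definition boundary A : set 'rV[R]_N := closure A `\` interior A.

Definition dist_to x A : R := inf [set enorm (x - y) | y in A].

Definition basis_vec (i : 'I_N) : 'rV[R]_N := delta_mx 0 i.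

Definition partial (i : 'I_N) (f : 'rV[R]_N -> R) : 'rV[R]_N -> R :=
  'D_(basis_vec i) f.

Fixpoint class_C (k : nat) (f : 'rV[R]_N -> R) : Prop :=
  match k with
  | 0%N => continuous f
  | k'.+1 => continuous f /\
      forall i, (forall x, derivable f x (basis_vec i)) /\
                class_C k' (partial i f)
  end.

Definition smooth (f : 'rV[R]_N -> R) : Prop := forall k, class_C k f.

End Geometry.

(* Near each boundary point, Omega lies on one side of the graph of a C^infinity
   function of the coordinates other than the i-th one ([col' i x] is x with
   the i-th coordinate removed); [s] is the orientation of the i-th axis.
   When N = 1 the function gamma is defined on R^0, i.e. it is a constant. *)
Definition smooth_boundary (R : realType) (N : nat) (Omega : set 'rV[R]_N) :=
  forall x0, boundary Omega x0 ->
    exists (i : 'I_N) (s : bool) (r : R) (gamma : 'rV[R]_(N.-1) -> R),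
      [/\ 0 < r, smooth gamma &
          forall x, enorm (x - x0) < r ->
            (Omega x <-> 0 < (-1) ^+ s * (x 0 i - gamma (col' i x)))].

Definition smooth_bounded_domain (R : realType) (N : nat)
    (Omega : set 'rV[R]_N) : Prop :=
  [/\ open Omega, connected Omega, Omega !=set0, bounded_set Omega &
      smooth_boundary Omega].

Section Parabolic.
Context {R : realType} {N : nat}.
Implicit Types (u : 'rV[R]_N -> R -> R) (x : 'rV[R]_N) (t : R).

Definition time_interval (T : \bar R) : set R :=
  [set t | 0 < t /\ (t%:E < T)%E].

Definition cylinder (Omega : set 'rV[R]_N) (T : \bar R) :
  set ('rV[R]_N * R) := Omega `*` time_interval T.

Definition dt u x t : R := derive1 (u x) t.

Definition dx (i : 'I_N) u x t : R := partial i (u ^~ t) x.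

Definition dxx (i j : 'I_N) u x t : R := dx i (dx j u) x t.

Definition grad u x t : 'rV[R]_N := \row_i dx i u x t.

Definition laplacian u x t : R := \sum_i dxx i i u x t.

Definition continuous_on (Q : set ('rV[R]_N * R)) u : Prop :=
  {within Q, continuous (fun p : 'rV[R]_N * R => u p.1 p.2)}.

Definition class_C21 (Q : set ('rV[R]_N * R)) u : Prop :=
  [/\ continuous_on Q u,
      (forall x t, Q (x, t) -> derivable (u x) t 1) /\ continuous_on Q (dt u),
      forall i,
        (forall x t, Q (x, t) -> derivable (u ^~ t) x (basis_vec i)) /\
        continuous_on Q (dx i u) &
      forall i j,
        (forall x t, Q (x, t) -> derivable (dx j u ^~ t) x (basis_vec i)) /\
        continuous_on Q (dxx i j u)].

Definition HJ_solution (q : R) (Q : set ('rV[R]_N * R)) u : Prop :=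
  forall x t, Q (x, t) ->
    dt u x t - laplacian u x t + enorm (grad u x t) `^ q = 0.

End Parabolic.

(* Main.v *)
Require Import Defs.
From mathcomp Require Import all_boot all_order all_algebra.
From mathcomp Require Import all_classical all_reals all_analysis.
From mathcomp Require Import ring lra.
Set Implicit Arguments.
Unset Strict Implicit.
Unset Printing Implicit Defensive.
Import Order.TTheory GRing.Theory Num.Theory.
Import numFieldNormedType.Exports.
Local Open Scope classical_set_scope.
Local Open Scope ring_scope.

(** The absorption term |grad u|^q makes a steep function decrease fast, so a
    barrier that is infinite at the initial time dominates every solution,
    whatever its initial data.  Fix a boundary point y and a quadratic
    polynomial phi with phi(y) = 0 and phi >= 0 on the closure of Omega whose
    gradient has norm at least 1 wherever phi >= 0.  With M the supremum of u
    on the lateral boundary and b = 1/(q-1), put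
      v(x, s) = M + K (1 + (s - t0)^(-b)) (phi(x) + eta),   0 < eta <= 1.
    Because -b - 1 = -b q, the time derivative of v is of the same order
    (s - t0)^(-b q) as |grad v|^q, and for K large, depending only on N, q and
    Omega, the gradient term wins over both it and the Laplacian:  v is a
    strict supersolution ([barrier_strict_supersolution]).  As v exceeds M on
    the lateral boundary and tends to infinity uniformly as s decreases to t0,
    the maximum principle gives u <= v ([barrier_comparison]).  Letting eta
    tend to 0 and choosing t0 = t/2, so that t - t0 is a fixed multiple of t,
    gives u(x, t) <= M + C (1 + t^(-b)) |x - y|
    ([bound_by_distance_to_point]); the infimum over y is the claim.

    The polynomial phi is the only place where the smoothness of the boundary
    matters.  Locally Omega is one side of the graph of a smooth function
    gamma, and the second order Taylor remainder of gamma says that Omega stays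
    above a paraboloid
      phi(x) = L |x - y|^2 + m . (x - y)
    through y, where m is an inner normal (1, - grad gamma) of the graph, up to
    orientation; this is an exterior ball condition in algebraic form, and
    |m| >= 1 since one coordinate of m is 1 or -1.  Compactness of
    the boundary makes L uniform in y ([uniform_supporting_paraboloid]).
    Completing the square gives |grad phi|^2 = 4 L phi + |m|^2 >= 1 ([paraboloid_gradient_sqr]).

    The regularity of gamma and u is given by their partial derivatives, not by
    Frechet differentiability.  The Taylor estimate is therefore obtained by
    moving one coordinate at a time with the one-variable mean value theorem
    ([coordinate_mean_value]), and the maximum principle uses one-variable
    tests along the coordinate axes ([touching_inequality]). *)

(** * Mean value and Taylor estimates along coordinate directions *)

Lemma is_derive_along_line (R : realType) (n : nat) (f : 'rV[R]_n -> R)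
    (x v : 'rV[R]_n) (h : R) :
  derivable f (h *: v + x) v ->
  is_derive h 1 (fun k => f (k *: v + x)) ('D_v f (h *: v + x)).
Proof.
have eqv : (fun k : R => k^-1 *: (f ((k *: (1 : R) + h) *: v + x) - f (h *: v + x)))
   = (fun k : R => k^-1 *: (f (k *: v + (h *: v + x)) - f (h *: v + x))).
  by apply/funext => k; rewrite addrA -scalerDl /GRing.scale /= mulr1.
move=> df; apply: DeriveDef; first by rewrite /derivable eqv.
by rewrite /derive eqv.
Qed.

Lemma mean_value_unordered (R : realType) (g dg : R -> R) (d : R) :
  (forall h : R, is_derive h 1 g (dg h)) ->
  exists2 c, Num.min 0 d <= c <= Num.max 0 d & g d - g 0 = dg c * d.
Proof.
move=> Dg.
have cg a b : {within `[a, b], continuous g}.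
  by apply: derivable_within_continuous => z _; exact: ex_derive.
have [d0|d0|->] := ltgtP d 0.
- have [c cI E] := MVT d0 (fun h _ => Dg h) (cg _ _).
  exists c; first by move: cI; rewrite in_itv /= => /andP[/ltW -> /ltW ->].
  by rewrite -[LHS]opprB E; ring.
- have [c cI E] := MVT d0 (fun h _ => Dg h) (cg _ _).
  exists c; first by move: cI; rewrite in_itv /= => /andP[/ltW -> /ltW ->].
  by rewrite E; ring.
- by exists 0; rewrite ?minxx ?maxxx ?lexx // !subrr mulr0.
Qed.

(** Telescoping over the points that take their first k coordinates from a and
    the others from b: consecutive points differ along one axis, where the
    one-variable mean value theorem applies, and all of them stay in every
    coordinate box that contains a and b. *)
Lemma coordinate_mean_value (R : realType) (n : nat) (f : 'rV[R]_n -> R)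
    (lo hi : 'I_n -> R) (g : 'I_n -> R) (eps : R) (a b : 'rV[R]_n) :
  (forall i (x : 'rV[R]_n), derivable f x (basis_vec i)) ->
  (forall x : 'rV[R]_n, (forall j, lo j <= x 0 j <= hi j) ->
     forall i, `|partial i f x - g i| <= eps) ->
  (forall j, lo j <= a 0 j <= hi j) -> (forall j, lo j <= b 0 j <= hi j) ->
  `|f a - f b - \sum_i g i * (a 0 i - b 0 i)| <=
     \sum_i eps * `|a 0 i - b 0 i|.
Proof.
move=> df Hg Ha Hb.
pose m k : 'rV[R]_n := \row_i (if (i < k)%N then a 0 i else b 0 i).
have m0 : m 0%N = b by apply/rowP => i; rewrite mxE.
have mn : m n = a by apply/rowP => i; rewrite mxE ltn_ord.
have mS (k : 'I_n) : m k.+1 = (a 0 k - b 0 k) *: basis_vec k + m k.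
  apply/rowP => i; rewrite !mxE /= ltnS eq_sym.
  case: (ltngtP i k) => [ik|ik|/val_inj ->].
  - have /negbTE -> : k != i by rewrite -val_eqE /= gtn_eqF.
    by rewrite mulr0 add0r.
  - have /negbTE -> : k != i by rewrite -val_eqE /= ltn_eqF.
    by rewrite mulr0 add0r.
  - by rewrite eqxx mulr1 subrK.
have -> : f a - f b = \sum_(k < n) (f (m k.+1) - f (m k)).
  by rewrite -(big_mkord xpredT (fun k => f (m k.+1) - f (m k)))
             telescope_sumr // mn m0.
rewrite -sumrB; apply: le_trans (ler_norm_sum _ _ _) _.
apply: ler_sum => k _.
have [c cI] := @mean_value_unordered R (fun h => f (h *: basis_vec k + m k))
  (fun h => partial k f (h *: basis_vec k + m k)) (a 0 k - b 0 k)
  (fun h => is_derive_along_line (df k _)).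
rewrite scale0r add0r -mS => ->.
rewrite -mulrBl normrM ler_wpM2r //; apply: Hg => j.
have := Ha j; have := Hb j; rewrite !mxE /=.
have [->|jk] := eqVneq j k.
  rewrite ltnn mulr1; move: cI.
  case: (leP 0 (a 0 k - b 0 k)) => ? /andP[? ?] /andP[? ?] /andP[? ?];
  by apply/andP; split; lra.
by rewrite mulr0 add0r; case: ifP.
Qed.

(** Neighbourhoods are used through closed coordinate boxes, since the mean
    value estimates move one coordinate at a time. *)
Lemma mx_near_box (R : realType) (n : nat) (c : 'rV[R]_n) (P : set 'rV[R]_n) :
  (\forall x \near c, P x) ->
  exists2 r, 0 < r & forall x : 'rV[R]_n, (forall j, `|x 0 j - c 0 j| <= r) -> P x.
Proof.
move=> /nbhs_ballP[e /= e0 He]; exists (e / 2); first by rewrite divr_gt0.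
move=> x Hx; apply: He; split=> // i j.
rewrite ord1 /ball /= distrC (le_lt_trans (Hx j)) //.
by rewrite ltr_pdivrMr // ltr_pMr // ltr1n.
Qed.

Lemma locally_bounded_family (R : realType) (n : nat) (I : finType)
    (F : I -> 'rV[R]_n -> R) (c : 'rV[R]_n) :
  (forall i, continuous (F i)) ->
  exists M, exists2 r, 0 < r & forall x : 'rV[R]_n, (forall j, `|x 0 j - c 0 j| <= r) ->
    forall i, `|F i x| <= M.
Proof.
move=> cF; have [M HM] : exists M, forall i, `|F i c| + 1 <= M.
  have /filter_ex : \forall M \near +oo, forall i, `|F i c| + 1 <= M.
    by apply: filter_forall => i; apply: nbhs_pinfty_ge; rewrite num_real.
  by [].
have near_c : \forall x \near c, forall i, `|F i x| <= M; last first.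
  by exists M; exact: mx_near_box near_c.
apply: (@filter_forall _ I (fun i => [set x | `|F i x| <= M]) (nbhs c)) => i.
have := cF i c; move=> /cvgr_dist_lt /(_ 1 ltr01).
apply: filterS => x /= Hx; apply: le_trans (HM i).
rewrite -lerBlDl; apply: le_trans (ltW Hx).
by rewrite distrC; apply: le_trans (lerB_dist _ _).
Qed.

(** The mean value estimate is used twice: on the first derivatives, whose
    partial derivatives are locally bounded, and then on f itself, whose
    first derivatives are thereby close to those at b on the coordinate hull
    of a and b. *)
Lemma local_taylor2 (R : realType) (n : nat) (f : 'rV[R]_n -> R) (c : 'rV[R]_n) :
  class_C 2 f ->
  exists M r, [/\ 0 <= M, 0 < r & forall a b : 'rV[R]_n,
    (forall j, `|a 0 j - c 0 j| <= r) -> (forall j, `|b 0 j - c 0 j| <= r) ->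
    (forall i, `|partial i f b| <= M) /\
    `|f a - f b - \sum_i partial i f b * (a 0 i - b 0 i)| <=
       M * (\sum_i `|a 0 i - b 0 i|) ^+ 2].
Proof.
move=> [_ C2].
have [M1 [r1 r1_gt0 H1]] := @locally_bounded_family _ _ _ (fun i => partial i f) c
  (fun i => (C2 i).2.1).
have [M2 [r2 r2_gt0 H2]] := @locally_bounded_family _ _ _
  (fun ij : 'I_n * 'I_n => partial ij.1 (partial ij.2 f)) c
  (fun ij => ((C2 ij.2).2.2 ij.1).2).
pose M := Num.max (Num.max M1 M2) 0; exists M, (Num.min r1 r2); split.
- by rewrite le_max lexx orbT.
- by rewrite lt_min r1_gt0.
have rr1 (x : 'rV[R]_n) : (forall j, `|x 0 j - c 0 j| <= Num.min r1 r2) ->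
    (forall j, `|x 0 j - c 0 j| <= r1).
  by move=> Hx j; have := Hx j; rewrite le_min => /andP[].
have rr2 (x : 'rV[R]_n) : (forall j, `|x 0 j - c 0 j| <= Num.min r1 r2) ->
    (forall j, `|x 0 j - c 0 j| <= r2).
  by move=> Hx j; have := Hx j; rewrite le_min => /andP[].
move=> a b Ha Hb; split=> [i|].
  by apply: le_trans (H1 _ (rr1 _ Hb) i) _; rewrite !le_max lexx.
set S := \sum_i `|_|.
have hull (x : 'rV[R]_n) : (forall j, Num.min (a 0 j) (b 0 j) <= x 0 j <= Num.max (a 0 j) (b 0 j)) ->
    (forall j, `|x 0 j - c 0 j| <= r2) /\ (forall j, `|x 0 j - b 0 j| <= `|a 0 j - b 0 j|).
  move=> Hx; split=> j; have := Hx j.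
    have := rr2 _ Ha j; have := rr2 _ Hb j; rewrite !ler_norml.
    by case: (leP (a 0 j) (b 0 j)) => ? /andP[? ?] /andP[? ?] /andP[? ?]; apply/andP; split; lra.
  rewrite ler_norml; case: (leP (a 0 j) (b 0 j)) => ab;
    [rewrite ler0_norm; last by lra|rewrite ger0_norm; last by lra];
    by move=> /andP[? ?]; apply/andP; split; lra.
have hulla j : Num.min (a 0 j) (b 0 j) <= a 0 j <= Num.max (a 0 j) (b 0 j).
  by rewrite ge_min le_max !lexx.
have hullb j : Num.min (a 0 j) (b 0 j) <= b 0 j <= Num.max (a 0 j) (b 0 j).
  by rewrite ge_min le_max !lexx !orbT.
apply: le_trans (@coordinate_mean_value _ _ f (fun j => Num.min (a 0 j) (b 0 j))
  (fun j => Num.max (a 0 j) (b 0 j)) (fun i => partial i f b) (M * S) a b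
  (fun i => (C2 i).1) _ hulla hullb) _; last first.
  by rewrite -mulr_sumr -/S -mulrA expr2.
move=> x Hx i; have [Hxr Hxb] := hull x Hx.
have := @coordinate_mean_value _ _ (partial i f) (fun j => Num.min (a 0 j) (b 0 j))
  (fun j => Num.max (a 0 j) (b 0 j)) (fun=> 0) M x b
  (fun j => ((C2 i).2.2 j).1) _ Hx hullb.
rewrite (eq_bigr (fun=> 0)) => [|j _]; last by rewrite mul0r.
rewrite big1 // subr0 => H; apply: le_trans (H _) _.
  move=> z Hz j; rewrite subr0; have [Hzr _] := hull z Hz.
  by apply: le_trans (H2 z Hzr (j, i)) _; rewrite !le_max lexx orbT.
rewrite -mulr_sumr ler_wpM2l ?le_max ?lexx ?orbT //.
by apply: ler_sum => j _.
Qed.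

(** * Supporting paraboloids of a smooth domain *)

Lemma sqr_sum_norm_le (R : realType) (n : nat) (d : 'I_n -> R) :
  (\sum_i `|d i|) ^+ 2 <= n%:R * \sum_i d i ^+ 2.
Proof.
have -> : n%:R * (\sum_i d i ^+ 2) =
    \sum_(i < n) \sum_(j < n) (d i ^+ 2 / 2 + d j ^+ 2 / 2).
  transitivity (\sum_(i < n) (n%:R * (d i ^+ 2 / 2) + (\sum_j d j ^+ 2) / 2)).
    rewrite big_split /= -mulr_sumr -mulr_suml sumr_const card_ord -mulr_natl.
    by field.
  apply: eq_bigr => i _.
  by rewrite big_split /= sumr_const card_ord mulr_natl mulr_suml.
rewrite expr2 mulr_suml; apply: ler_sum => i _.
rewrite mulr_sumr; apply: ler_sum => j _.
rewrite -(real_normK (num_real (d i))) -(real_normK (num_real (d j))).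
have := sqr_ge0 (`|d i| - `|d j|); nra.
Qed.

Lemma ler_enorm_coord (R : realType) (n : nat) (x : 'rV[R]_n) (j : 'I_n) :
  `|x 0 j| <= enorm x.
Proof.
rewrite -sqrtr_sqr ler_wsqrtr // (bigD1 j) //= lerDl.
by apply: sumr_ge0 => k _; exact: sqr_ge0.
Qed.

Lemma enorm_le_box (R : realType) (n : nat) (x : 'rV[R]_n) (r : R) :
  0 <= r -> (forall j, `|x 0 j| <= r) -> enorm x <= n%:R * r.
Proof.
move=> r0 Hx; have nr0 : 0 <= n%:R * r by rewrite mulr_ge0.
rewrite -(ger0_norm nr0) -sqrtr_sqr ler_wsqrtr //.
apply: (@le_trans _ _ (\sum_(j < n) r ^+ 2)).
  apply: ler_sum => j _; rewrite -(real_normK (num_real _)).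
  by rewrite lerXn2r ?nnegrE.
rewrite sumr_const card_ord -[leLHS]mulr_natl exprMn ler_wpM2r ?sqr_ge0 //.
rewrite -natrX ler_nat; case: (n) => // k; exact: leq_pmull.
Qed.

Definition paraboloid {R : realType} {N : nat} (L : R) (m : 'I_N -> R)
    (y x : 'rV[R]_N) : R :=
  \sum_k (L * (x 0 k - y 0 k) ^+ 2 + m k * (x 0 k - y 0 k)).

(** The single constant L bounds both the opening and the slopes, so that a
    compactness argument has only one parameter to control. *)
Definition supporting_paraboloid {R : realType} {N : nat}
    (Omega : set 'rV[R]_N) (L : R) (y : 'rV[R]_N) : Prop :=
  exists m : 'I_N -> R, [/\ forall k, `|m k| <= L, 1 <= \sum_k m k ^+ 2 &
    forall x, Omega x -> 0 <= paraboloid L m y x].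

(** The coefficients m form an inner normal (1, - grad gamma) of the graph,
    up to the orientation sigma.  Close to x0 the Taylor remainder of gamma is
    absorbed by L |x - y|^2; at distance at least d/2 from y, the quadratic
    term dominates the linear one as soon as L is large compared with 1/d. *)
Lemma local_supporting_paraboloid (R : realType) (N : nat)
    (Omega : set 'rV[R]_N) (x0 : 'rV[R]_N) :
  open Omega -> smooth_boundary Omega -> boundary Omega x0 ->
  exists L0 d, 0 < d /\ forall y, boundary Omega y ->
    (forall j, `|y 0 j - x0 0 j| <= d) ->
    forall L, L0 <= L -> supporting_paraboloid Omega L y.
Proof.
move=> oO sO bx0; have [i [s [r [gamma [r0 Cgamma Hr]]]]] := sO _ bx0.
set sigma : R := (-1) ^+ s in Hr *.
have sigma_sqr : sigma * sigma = 1 by rewrite -expr2 sqrr_sign.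
have norm_sigma : `|sigma| = 1 by rewrite normr_sign.
have [M [rt [M0 rt0 HT]]] := @local_taylor2 _ _ gamma (col' i x0) (Cgamma 2%N).
pose n := N.+1%:R : R.
have n0 : 0 < n by rewrite ltr0n.
pose d := Num.min (r / n) rt.
have d0 : 0 < d by rewrite lt_min rt0 divr_gt0.
pose B := Num.max M 1.
have B0 : 0 < B by rewrite lt_max ltr01 orbT.
exists (Num.max B (Num.max (M * n) (B * n * (2 / d)))), (d / 2); split; first by rewrite divr_gt0.
move=> y bY yx0 L; rewrite ge_max => /andP[LL]; rewrite ge_max => /andP[LM LB].
have inball (x : 'rV[R]_N) : (forall j, `|x 0 j - x0 0 j| <= d) -> enorm (x - x0) < r.
  move=> Hx; have Hx' j : `|(x - x0) 0 j| <= r / n.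
    by rewrite !mxE; apply: le_trans (Hx j) _; rewrite ge_min lexx.
  apply: le_lt_trans (@enorm_le_box _ _ (x - x0) (r / n) _ Hx') _.
    by rewrite divr_ge0 // ltW.
  by rewrite mulrCA -[ltRHS]mulr1 ltr_pM2l // ltr_pdivrMr // mul1r ltr_nat.
have yd j : `|y 0 j - x0 0 j| <= d by apply: le_trans (yx0 j) _; lra.
have incol (x : 'rV[R]_N) : (forall j, `|x 0 j - x0 0 j| <= d) ->
    forall j, `|col' i x 0 j - col' i x0 0 j| <= rt.
  by move=> Hx j; rewrite !mxE; apply: le_trans (Hx _) _; rewrite ge_min lexx orbT.
(* As Omega is open, y is not in Omega, hence lies on the graph or beyond it. *)
have ynO : sigma * (y 0 i - gamma (col' i y)) <= 0.
  rewrite leNgt; apply/negP => /(Hr _ (inball _ yd)) Oy.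
  by case: bY => _; apply; rewrite (interior_id Omega).1.
pose m k := if unlift i k is Some j then - sigma * partial j gamma (col' i y) else sigma.
have [gB _] := HT _ _ (incol _ yd) (incol _ yd).
have mB k : `|m k| <= B.
  rewrite /m; case: unlift => [j|]; last by rewrite norm_sigma le_max lexx orbT.
  by rewrite normrM normrN norm_sigma mul1r le_max gB.
have sumE (F : 'I_N -> R) : \sum_k F k = F i + \sum_j F (lift i j).
  by rewrite (bigD1_ord i).
exists m; split=> [k||x Ox]; first exact: le_trans (mB k) LL.
  rewrite sumE /m unlift_none expr2 sigma_sqr lerDl.
  by apply: sumr_ge0 => k _; exact: sqr_ge0.
rewrite /paraboloid big_split /= -mulr_sumr.
set Q := \sum_k _ ^+ 2.
have Q0 : 0 <= Q by apply: sumr_ge0 => k _; exact: sqr_ge0.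
have [xd|/existsNP[k /negP]] := pselect (forall j, `|x 0 j - x0 0 j| <= d).
  have xO := (Hr _ (inball _ xd)).1 Ox.
  have [_ T] := HT _ _ (incol _ xd) (incol _ yd).
  have ml j : m (lift i j) = - (sigma * partial j gamma (col' i y)).
    by rewrite /m liftK mulNr.
  rewrite sumE {1}/m unlift_none.
  under eq_bigr do rewrite ml mulNr -mulrA.
  rewrite sumrN -mulr_sumr.
  have QT : M * (\sum_j `|col' i x 0 j - col' i y 0 j|) ^+ 2 <= L * Q.
    apply: le_trans (ler_wpM2r Q0 LM); rewrite -mulrA ler_wpM2l //.
    apply: le_trans (@sqr_sum_norm_le _ _ (fun j => col' i x 0 j - col' i y 0 j)) _.
    rewrite ler_pM // ?ler_nat ?leqW ?leq_pred //.
      by apply: sumr_ge0 => k _; exact: sqr_ge0.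
    rewrite /Q sumE; under eq_bigr do rewrite !mxE.
    by rewrite lerDr sqr_ge0.
  have {T QT}T := le_trans T QT.
  have : `|sigma * (gamma (col' i x) - gamma (col' i y) -
      \sum_j partial j gamma (col' i y) * (col' i x 0 j - col' i y 0 j))| <= L * Q.
    by rewrite normrM norm_sigma mul1r.
  under eq_bigr do rewrite !mxE.
  rewrite ler_norml => /andP[+ _].
  set P := \sum_j _ => {}T.
  move: xO ynO; rewrite !mulrBr; rewrite !mulrBr in T; lra.
(* The coordinate k takes x out of the box of radius d, while y is in the box
   of radius d / 2. *)
rewrite -ltNge => xk.
set S := \sum_k `|x 0 k - y 0 k|.
have S_ge : d / 2 <= S.
  rewrite /S (bigD1 k) //=; apply: (@le_trans _ _ `|x 0 k - y 0 k|).
    have := yx0 k; have := ler_distD (y 0 k) (x 0 k) (x0 0 k); lra.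
  by rewrite lerDl; apply: sumr_ge0.
have S0 : 0 < S by apply: lt_le_trans S_ge; rewrite divr_gt0.
have mS : - (B * S) <= \sum_k m k * (x 0 k - y 0 k).
  apply: (lerNnormlW); rewrite /S mulr_sumr; apply: le_trans (ler_norm_sum _ _ _) _.
  by apply: ler_sum => j _; rewrite normrM ler_wpM2r.
suff : B * S <= L * Q by lra.
apply: le_trans (ler_wpM2r Q0 LB).
have SQ : S ^+ 2 <= n * Q.
  apply: le_trans (@sqr_sum_norm_le _ _ (fun j => x 0 j - y 0 j)) _.
  by rewrite ler_wpM2r // ler_nat.
have -> : B * n * (2 / d) * Q = B * ((n * Q) * (2 / d)) by ring.
apply: (ler_wpM2l (ltW B0)).
rewrite mulrA ler_pdivlMr //; apply: le_trans (ler_wpM2r _ SQ); last by [].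
by rewrite expr2; nra.
Qed.

Lemma continuous_paraboloid (R : realType) (N : nat)
    (L : R) (m : 'I_N -> R) (y : 'rV[R]_N) : continuous (paraboloid L m y).
Proof.
apply: (@continuous_big _ _ _ 0 xpredT (@add_continuous R)) => k _ x.
have cx : {for x, continuous (fun z : 'rV[R]_N => z 0 k - y 0 k)}.
  by apply: continuousB; [exact: coord_continuous|exact: cst_continuous].
apply: (@continuousD _ _ _ (fun z : 'rV[R]_N => L * (z 0 k - y 0 k) ^+ 2)
  (fun z => m k * (z 0 k - y 0 k))); apply: continuousM.
- exact: cst_continuous.
- exact: (continuousM cx cx).
- exact: cst_continuous.
- exact: cx.
Qed.

Lemma compact_closure_bounded (R : realType) (N : nat) (Omega : set 'rV[R]_N) :
  bounded_set Omega -> compact (closure Omega).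
Proof.
move=> [M [Mr HM]]; apply: bounded_closed_compact; last exact: closed_closure.
exists M; split=> // e Me x clx.
have : closed [set z : 'rV[R]_N | `|z| <= e].
  apply: (@preimage_closed _ _ (fun z : 'rV[R]_N => `|z|) [set r | r <= e]).
    by move=> z _; exact: norm_continuous.
  exact: closed_le.
move=> /closure_id -> ; apply: closure_subset clx => z Oz; exact: HM.
Qed.

Lemma uniform_supporting_paraboloid (R : realType) (N : nat)
    (Omega : set 'rV[R]_N) :
  open Omega -> bounded_set Omega -> smooth_boundary Omega ->
  exists2 L, 1 <= L & forall y, boundary Omega y -> supporting_paraboloid Omega L y.
Proof.
move=> oO bO sO.
have cB : compact (boundary Omega).
  apply: (subclosed_compact _ (compact_closure_bounded bO)); last by move=> x [].
  apply: closedI; first exact: closed_closure.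
  by apply: open_closedC; exact: open_interior.
have : \forall L \near +oo, boundary Omega `<=`
    (fun y => supporting_paraboloid Omega L y).
  apply: ((near_covering_withinP _).2 ((compact_near_coveringP _).1 cB)).
  move=> x0 /(local_supporting_paraboloid oO sO)[L0 [d [d0 H]]].
  exists ([set y : 'rV[R]_N | forall j, `|y 0 j - x0 0 j| <= d], [set L | L0 <= L]).
    split=> /=; last by apply: nbhs_pinfty_ge; rewrite num_real.
    apply/nbhs_ballP; exists d => //= y [_ Hy] j.
    by have := Hy 0 j; rewrite /ball /= distrC => /ltW.
  by move=> [y L] [/= Hy HL] By; exact: H.
move=> HL.
have : \forall L \near +oo, 1 <= L /\ boundary Omega `<=`
    (fun y => supporting_paraboloid Omega L y).
  by apply: filterI HL; apply: nbhs_pinfty_ge; rewrite num_real.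
by move=> /filter_ex[L [L1 HL']]; exists L.
Qed.

(** * One-variable tests at a maximum *)

(** A one-sided form of differentiability that makes the sign of a derivative
    usable at a maximum: it serves both the time derivative and the second
    space derivative. *)
Lemma difference_quotient_gt (R : realType) (k : R -> R) (s D c : R) :
  is_derive s 1 k D -> c < D ->
  exists2 e, 0 < e & forall h, h != 0 -> `|h| < e ->
    c < (k (h + s) - k s) / h.
Proof.
move=> [dk Dk] cD.
have : (fun h : R => h^-1 *: (k (h *: (1 : R) + s) - k s)) @ 0^' --> D.
  by rewrite -Dk; exact: dk.
move=> /cvgr_gt /(_ _ cD) /nbhs_ballP[e /= e0 He]; exists e => // h h0 he.
have bh : ball 0 e h by rewrite -ball_normE /ball_ /= sub0r normrN.
have := He h bh h0.
by rewrite /= /GRing.scale /= mulr1 mulrC.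
Qed.

Lemma derive_ge0_at_left_max (R : realType) (k : R -> R) (s D d : R) :
  0 < d -> is_derive s 1 k D -> (forall r, s - d < r <= s -> k r <= k s) ->
  0 <= D.
Proof.
move=> d0 Dk kmax; rewrite leNgt; apply/negP => D0.
have Dnk : is_derive s 1 (- k) (- D) by exact: is_deriveN.
have nD0 : 0 < - D by rewrite oppr_gt0.
have [e e0 He] := difference_quotient_gt Dnk nD0.
pose h := Num.min e d / 2.
have h0 : 0 < h by rewrite divr_gt0 // lt_min e0.
have hm : h < Num.min e d by rewrite ltr_pdivrMr // ltr_pMr ?ltr1n // lt_min e0.
move: hm; rewrite lt_min => /andP[he hd].
have := He (- h); rewrite oppr_eq0 gt_eqF // normrN gtr0_norm // => /(_ isT he).
rewrite invrN mulrN oppr_gt0 pmulr_llt0 ?invr_gt0 //.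
have : k (- h + s) <= k s by apply: kmax; apply/andP; split; lra.
by rewrite !fctE; lra.
Qed.

(** The difference G of g and the parabola has a local maximum at 0, so its
    first derivative vanishes there; were its second derivative positive, the
    mean value theorem would make G increase to the right of 0. *)
Lemma second_order_touching (R : realType) (g dg : R -> R) (ddg a b d : R) :
  0 < d -> (forall h : R, `|h| < d -> is_derive h 1 g (dg h)) ->
  is_derive (0 : R) 1 dg ddg ->
  (forall h, `|h| < d -> g h <= g 0 + a * h + b * h ^+ 2) ->
  dg 0 = a /\ ddg <= 2 * b.
Proof.
move=> d0 Dg Ddg gle.
pose G h := g h - (a * h + b * h ^+ 2).
have DP (h : R) : is_derive h 1 (fun h => a * h + b * h ^+ 2) (a + 2 * b * h).
  by apply: is_derive_eq; rewrite /GRing.scale /=; ring.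
have DG (h : R) : `|h| < d -> is_derive h 1 G (dg h - (a + 2 * b * h)).
  by move=> hd; have Dgh := Dg h hd; exact: is_deriveB.
have G0 : G 0 = g 0 by rewrite /G; ring.
have dg0 : dg 0 = a.
  have I (h : R) : h \in `]- d, d[%R -> `|h| < d by rewrite in_itv /= ltr_norml.
  have : is_derive (0 : R) 1 G 0.
    apply: (@derive1_at_max _ G (- d) d) => [|h /I /DG|| h /I hd].
    - lra.
    - by move=> ?; exact: ex_derive.
    - by rewrite in_itv /= oppr_lt0 d0.
    - by rewrite G0 /G; have := gle _ hd; lra.
  move=> /@derive_val; have := DG 0; rewrite normr0 => /(_ d0) /@derive_val ->.
  by lra.
split=> //; rewrite leNgt; apply/negP => bdd.
have DdG : is_derive (0 : R) 1 (fun h => dg h - (a + 2 * b * h)) (ddg - 2 * b).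
  apply: is_deriveB; apply: is_derive_eq; rewrite /GRing.scale /=; ring.
have [e e0 He] := @difference_quotient_gt _ _ _ _ 0 DdG ltac:(lra).
pose h := Num.min e d / 2.
have h0 : 0 < h by rewrite divr_gt0 // lt_min e0.
have hm : h < Num.min e d by rewrite ltr_pdivrMr // ltr_pMr ?ltr1n // lt_min e0.
move: hm; rewrite lt_min => /andP[he hd].
have I (r : R) : 0 <= r <= h -> `|r| < d by rewrite ltr_norml => /andP[? ?]; lra.
have [||c] := @MVT _ G (fun h => dg h - (a + 2 * b * h)) 0 h h0.
- by move=> r; rewrite in_itv /= => /andP[? ?]; apply: DG; apply: I; lra.
- apply: derivable_within_continuous => r; rewrite in_itv /= => /I /DG.
  by move=> ?; exact: ex_derive.
rewrite in_itv /= => /andP[c0 ch].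
have cn0 : c != 0 by rewrite gt_eqF.
have := He c cn0; rewrite gtr0_norm // addr0 => /(_ ltac:(lra)).
rewrite dg0 mulr0 addr0 subrr subr0 pmulr_lgt0 ?invr_gt0 // => dG.
rewrite subr0 => E.
have : G h <= G 0.
  rewrite G0 /G; have := gle h; rewrite gtr0_norm // => /(_ hd); lra.
have : 0 < (dg c - (a + 2 * b * c)) * h by rewrite mulr_gt0.
by rewrite -E; lra.
Qed.

Lemma open_coordinate_segment (R : realType) (N : nat) (Omega : set 'rV[R]_N)
    (x : 'rV[R]_N) :
  open Omega -> Omega x ->
  exists2 e, 0 < e & forall i (h : R), `|h| < e ->
    Omega (h *: basis_vec i + x).
Proof.
move=> oO Ox.
have [e e0 He] := mx_near_box (open_nbhs_nbhs (conj oO Ox)).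
exists e => // i h he; apply: He => j; rewrite !mxE addrK normrM.
apply: le_trans (ltW he); rewrite -[leRHS]mulr1 ler_wpM2l //.
by rewrite normr_nat lern1 leq_b1.
Qed.

(** The test at a maximum of u - v, stated without differentiating v: it is
    enough that u stays below a parabola of common opening kappa along each
    axis, which forces grad u = p and bounds the Laplacian by 2 N kappa. *)
Lemma touching_inequality (R : realType) (N : nat) (Omega : set 'rV[R]_N)
    (q : R) (T : \bar R) (u : 'rV[R]_N -> R -> R) (x : 'rV[R]_N) (s : R)
    (p : 'I_N -> R) (kappa d D : R) :
  open Omega -> class_C21 (cylinder Omega T) u ->
  HJ_solution q (cylinder Omega T) u -> cylinder Omega T (x, s) -> 0 < d ->
  (forall i h, `|h| < d ->
     u (h *: basis_vec i + x) s <= u x s + p i * h + kappa * h ^+ 2) ->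
  D <= dt u x s ->
  D - N%:R * (2 * kappa) + Num.sqrt (\sum_i p i ^+ 2) `^ q <= 0.
Proof.
move=> oO [_ _ C1 C2] HJ [/= Ox Ts] d0 ule Dle.
have [e e0 He] := open_coordinate_segment oO Ox.
pose d' := Num.min d e.
have d'0 : 0 < d' by rewrite lt_min d0.
have touch i : dx i u x s = p i /\ dxx i i u x s <= 2 * kappa.
  have := @second_order_touching _ (fun h => u (h *: basis_vec i + x) s)
    (fun h => dx i u (h *: basis_vec i + x) s) (dxx i i u x s) (p i) kappa d' d'0.
  rewrite scale0r add0r; apply.
  - move=> h; rewrite lt_min => /andP[_ he].
    apply: (@is_derive_along_line _ _ (u ^~ s)).
    by apply: (C1 i).1; split=> //; exact: He.
  - have := @is_derive_along_line _ _ (dx i u ^~ s) x (basis_vec i) 0.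
    rewrite scale0r add0r; apply.
    exact: (C2 i i).1.
  - by move=> h; rewrite lt_min => /andP[hd _]; exact: ule.
have Lle : laplacian u x s <= N%:R * (2 * kappa).
  rewrite mulr_natl -[X in _ *+ X]card_ord -sumr_const.
  by apply: ler_sum => i _; case: (touch i).
have Eg : enorm (grad u x s) = Num.sqrt (\sum_i p i ^+ 2).
  by congr (Num.sqrt _); apply: eq_bigr => i _; rewrite mxE (touch i).1.
have := HJ x s (conj Ox Ts); rewrite Eg; lra.
Qed.


(** * Geometry of the barrier *)

(** A point of the closure with maximal first coordinate cannot be interior. *)
Lemma boundary_nonempty (R : realType) (N : nat) (Omega : set 'rV[R]_N) :
  (0 < N)%N -> bounded_set Omega -> Omega !=set0 -> boundary Omega !=set0.
Proof.
move=> N0 bO [x0 Ox0]; pose i0 := Ordinal N0.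
have clO0 : closure Omega !=set0 by exists x0; exact: subset_closure.
have [c /set_mem clc cmax] := @compact_EVT_max _ _ (fun z : 'rV[R]_N => z 0 i0) _ clO0
  (compact_closure_bounded bO) (continuous_subspaceT (@coord_continuous R 1 N 0 i0)).
exists c; split=> // ic.
have [e e0 He] := open_coordinate_segment (@open_interior _ Omega) ic.
have e2 : `|e / 2| < e by rewrite gtr0_norm ?divr_gt0 // ltr_pdivrMr // ltr_pMr ?ltr1n.
have := cmax _ (mem_set (subset_closure (interior_subset (He i0 _ e2)))).
by rewrite !mxE !eqxx mulr1; lra.
Qed.

Lemma paraboloid_shift (R : realType) (N : nat) (L : R) (m : 'I_N -> R)
    (y x : 'rV[R]_N) (i : 'I_N) (h : R) :
  paraboloid L m y (h *: basis_vec i + x) =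
    paraboloid L m y x + (2 * L * (x 0 i - y 0 i) + m i) * h + L * h ^+ 2.
Proof.
rewrite /paraboloid (bigD1 i) //= [in RHS](bigD1 i) //= !mxE !eqxx mulr1.
rewrite (eq_bigr (fun k => L * (x 0 k - y 0 k) ^+ 2 + m k * (x 0 k - y 0 k))).
  by ring.
by move=> k /negbTE ki; rewrite !mxE ki andbF mulr0 add0r.
Qed.

(** Completing the square: on the set where the paraboloid is nonnegative, its
    gradient is at least as long as m. *)
Lemma paraboloid_gradient_sqr (R : realType) (N : nat) (L : R) (m : 'I_N -> R)
    (y x : 'rV[R]_N) :
  \sum_i (2 * L * (x 0 i - y 0 i) + m i) ^+ 2 =
    4 * L * paraboloid L m y x + \sum_i m i ^+ 2.
Proof.
rewrite /paraboloid mulr_sumr -big_split /=; apply: eq_bigr => i _; ring.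
Qed.

Lemma paraboloid_le (R : realType) (N : nat) (L rho : R) (m : 'I_N -> R)
    (y x : 'rV[R]_N) :
  0 <= L -> (forall k, `|m k| <= L) -> (forall k, `|x 0 k - y 0 k| <= rho) ->
  paraboloid L m y x <= N%:R * (L * (rho + 1)) * enorm (x - y).
Proof.
move=> L0 mL xy.
have -> : N%:R * (L * (rho + 1)) * enorm (x - y) =
    \sum_(k < N) L * (rho + 1) * enorm (x - y).
  by rewrite sumr_const card_ord -[RHS]mulr_natl; ring.
apply: ler_sum => k _.
have dk : `|x 0 k - y 0 k| <= enorm (x - y).
  by have := ler_enorm_coord (x - y) k; rewrite !mxE.
rewrite -(real_normK (num_real (x 0 k - y 0 k))).
have d0 := normr_ge0 (x 0 k - y 0 k).
apply: (@le_trans _ _ (L * (rho + 1) * `|x 0 k - y 0 k|)); last first.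
  by rewrite ler_wpM2l // mulr_ge0 //; have := xy k; lra.
have H1 : m k * (x 0 k - y 0 k) <= L * `|x 0 k - y 0 k|.
  by apply: le_trans (ler_norm _) _; rewrite normrM ler_wpM2r.
have H2 : L * `|x 0 k - y 0 k| ^+ 2 <= L * rho * `|x 0 k - y 0 k|.
  by rewrite expr2 -mulrA ler_wpM2l // ler_wpM2r.
lra.
Qed.

(** * The barrier and the comparison principle *)

(** With g = tau^(-b) and f = 1 + g, the three terms are K b g^q Phi,
    2 n L K f and X^q.  Since f >= 1, both g^q and f are at most f^q, while
    X^q >= K^q f^q = K K^(q-1) f^q, so the lower bound on K^(q-1) settles the
    sign. *)
Lemma barrier_strict_supersolution (R : realType)
    (q K P n L tau Phi X : R) :
  1 < q -> 0 < K -> 0 < tau -> 0 <= n -> 0 <= L -> 0 <= Phi <= P ->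
  1 / (q - 1) * P + n * (2 * L) < K `^ (q - 1) ->
  K * (1 + tau `^ (- (1 / (q - 1)))) <= X ->
  0 < K * (- (1 / (q - 1)) * tau `^ (- (1 / (q - 1)) - 1)) * Phi
      - n * (2 * (K * (1 + tau `^ (- (1 / (q - 1)))) * L)) + X `^ q.
Proof.
move=> q1 K0 tau0 n0 L0 /andP[Phi0 PhiP] HK.
set b := 1 / (q - 1) in HK *.
have q0 : 0 < q by lra.
have b0 : 0 < b by rewrite divr_gt0 //; lra.
have -> : - b - 1 = - b * q by rewrite /b; field; rewrite gt_eqF //; lra.
rewrite powRrM; set g := tau `^ (- b); set f := 1 + g => HX.
have g0 : 0 < g by exact: powR_gt0.
have fE : f = 1 + g by [].
have f1 : 1 <= f by lra.
have f0 : 0 <= f by lra.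
have gf : g `^ q <= f `^ q.
  by apply: ge0_ler_powR; rewrite ?nnegrE //; lra.
have ff : f <= f `^ q by apply: le1r_powR => //; exact: ltW.
have Xq : K * K `^ (q - 1) * f `^ q <= X `^ q.
  rewrite mulr_powRB1 ?(ltW K0) // -powRM ?(ltW K0) //.
  have Kf0 : 0 <= K * f by rewrite mulr_ge0 // ltW.
  by apply: ge0_ler_powR; rewrite ?nnegrE ?(ltW q0) // (le_trans Kf0).
have gq0 : 0 <= g `^ q by exact: powR_ge0.
set F := f `^ q in gf ff Xq *; set Gq := g `^ q in gf gq0 *.
have H1 : Gq * Phi <= F * P by exact: ler_pM.
have F0 : 0 < F by lra.
have H2 : n * (2 * L) * f <= n * (2 * L) * F by rewrite ler_wpM2l // mulr_ge0 // mulr_ge0.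
have H3 : b * (Gq * Phi) <= b * (F * P) by rewrite ler_wpM2l // ltW.
have H4 : 0 < K * F * (K `^ (q - 1) - (b * P + n * (2 * L))).
  by rewrite !mulr_gt0 // subr_gt0.
have H5 : K * (b * (Gq * Phi) + n * (2 * L) * f) <= K * (b * (F * P) + n * (2 * L) * F).
  by rewrite ler_wpM2l ?(ltW K0) // lerD.
lra.
Qed.

Lemma is_derive_barrier_profile (R : realType) (K b t0 s Phi : R) : t0 < s ->
  is_derive s 1 (fun r => K * (1 + (r - t0) `^ (- b)) * Phi)
    (K * (- b * (s - t0) `^ (- b - 1)) * Phi).
Proof.
move=> ts; have st0 : 0 < s - t0 by rewrite subr_gt0.
have D1 := @is_derive1_powR _ (- b) _ st0.
have D2 : is_derive s 1 (fun r : R => (r - t0) `^ (- b)) (- b * (s - t0) `^ (- b - 1)).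
  have -> : - b * (s - t0) `^ (- b - 1) = (- b * (s - t0) `^ (- b - 1)) *: (1 : R).
    by rewrite /GRing.scale /= mulr1.
  apply: (@is_derive1_comp _ (fun x => x `^ (- b)) (fun r => r - t0)).
  by apply: is_derive_eq; rewrite subr0.
by apply: is_derive_eq; rewrite /GRing.scale /=; ring.
Qed.

(** The barrier exceeds any prescribed value shortly after its initial time;
    this replaces an infinite initial condition. *)
Lemma barrier_profile_large (R : realType) (K b U eta t1 : R) :
  0 < K -> 0 < b -> 0 < eta -> 0 < t1 ->
  exists tau, 0 < tau < t1 /\ U < K * (1 + tau `^ (- b)) * eta.
Proof.
move=> K0 b0 eta0 t10.
(* tau^(-b) >= Y is equivalent to tau <= Y^(-1/b). *)
pose Y := `|U| / (K * eta) + 1.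
have Y0 : 0 < Y by rewrite ltr_wpDl // divr_ge0 // ltW // mulr_gt0.
pose tau := Num.min (Y `^ (- b^-1)) (t1 / 2).
have tau0 : 0 < tau by rewrite lt_min powR_gt0 // divr_gt0.
exists tau; split.
  rewrite tau0 /=; apply: (@le_lt_trans _ _ (t1 / 2)); first by rewrite ge_min lexx orbT.
  lra.
have Yle : Y <= tau `^ (- b).
  have -> : Y = (Y `^ (- b^-1)) `^ (- b).
    rewrite -powRrM mulrNN mulVf ?gt_eqF // powRr1 //; exact: ltW.
  rewrite !powRN lef_pV2 ?posrE ?powR_gt0 ?invr_gt0 ?powR_gt0 //.
  apply: ge0_ler_powR; rewrite ?nnegrE ?(ltW b0) ?(ltW tau0) //.
    by rewrite invr_ge0 powR_ge0.
  by rewrite -powRN ge_min lexx.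
have Ke : 0 < K * eta by rewrite mulr_gt0.
have E : `|U| = (Y - 1) * (K * eta) by rewrite /Y addrK mulfVK // gt_eqF.
have H : Y * (K * eta) <= tau `^ (- b) * (K * eta) by rewrite ler_pM2r.
have := ler_norm U; lra.
Qed.

(** Let v be the barrier without the constant M.  At a maximum point (z, s) of
    u - v with value above M, the point z is not on the boundary and s is not
    the initial time s0, which is chosen so close to t0 that u < M + v there.
    The tests at this maximum then contradict the strict supersolution
    inequality.  The final time s = t is allowed since only times before s are
    compared. *)
Lemma barrier_comparison (R : realType) (N : nat) (Omega : set 'rV[R]_N)
    (q : R) (T : \bar R) (u : 'rV[R]_N -> R -> R) (M L K P t0 t eta : R)
    (m : 'I_N -> R) (y : 'rV[R]_N) :
  1 < q -> open Omega -> bounded_set Omega ->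
  continuous_on (cylinder (closure Omega) T) u ->
  class_C21 (cylinder Omega T) u -> HJ_solution q (cylinder Omega T) u ->
  (forall z s, boundary Omega z -> time_interval T s -> u z s <= M) ->
  1 <= L -> 1 <= \sum_k m k ^+ 2 ->
  (forall x, closure Omega x -> 0 <= paraboloid L m y x) ->
  (forall x, Omega x -> paraboloid L m y x + eta <= P) ->
  0 < eta -> 0 < K -> 1 / (q - 1) * P + N%:R * (2 * L) < K `^ (q - 1) ->
  0 < t0 -> t0 < t -> time_interval T t ->
  forall x, Omega x ->
  u x t <= M + K * (1 + (t - t0) `^ (- (1 / (q - 1)))) * (paraboloid L m y x + eta).
Proof.
move=> q1 oO bO cu uC HJ uM L1 m1 phi0 phiP eta0 K0 HK t00 t0t [t_gt0 tT] x Ox.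
set b := 1 / (q - 1).
have b0 : 0 < b by rewrite divr_gt0 // subr_gt0.
have Tint s : t0 <= s <= t -> time_interval T s.
  move=> /andP[s0 st]; split; first exact: lt_le_trans s0.
  by apply: le_lt_trans tT; rewrite lee_fin.
have cyl s1 : t0 <= s1 -> closure Omega `*` `[s1, t] `<=` cylinder (closure Omega) T.
  move=> ts1 [z s] /= [clz]; rewrite in_itv /= => /andP[? ?]; split => //=.
  by apply: Tint; apply/andP; split => //; exact: le_trans ts1 _.
have cptD s1 : compact (closure Omega `*` `[s1, t]).
  by apply: compact_setX; [exact: compact_closure_bounded|exact: segment_compact].
have D0 s1 : s1 <= t -> closure Omega `*` `[s1, t] !=set0.
  move=> s1t; exists (x, t); split => /=; first exact: subset_closure.
  by rewrite in_itv /= s1t lexx.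
have [[zU sU] _ HU] := compact_EVT_max (D0 t0 (ltW t0t)) (cptD t0)
  (continuous_subspaceW (cyl t0 (lexx _)) cu).
have tt0 : 0 < t - t0 by rewrite subr_gt0.
have [tau [/andP[tau0 taut] Htau]] := barrier_profile_large (u zU sU - M) K0 b0 eta0 tt0.
pose s0 := t0 + tau.
have t0s0 : t0 < s0 by rewrite ltrDl.
have s0t : s0 <= t by rewrite /s0; lra.
pose v (p : 'rV[R]_N * R) :=
  K * (1 + (p.2 - t0) `^ (- b)) * (paraboloid L m y p.1 + eta).
have cv : {within closure Omega `*` `[s0, t], continuous v}.
  apply: continuous_in_subspaceT => -[z s] /set_mem [/= _].
  rewrite in_itv /= => /andP[s0s _].
  have cs : {for s, continuous (fun r => K * (1 + (r - t0) `^ (- b)) * 1)}.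
    apply: differentiable_continuous; apply/derivable1_diffP.
    have := @is_derive_barrier_profile _ K b t0 s 1 (lt_le_trans t0s0 s0s).
    by move=> ?; exact: ex_derive.
  have -> : v = (fun p => (K * (1 + (p.2 - t0) `^ (- b)) * 1) *
      (paraboloid L m y p.1 + eta)) by apply/funext => p; rewrite mulr1.
  apply: (@continuousM _ _ (fun p : 'rV[R]_N * R => K * (1 + (p.2 - t0) `^ (- b)) * 1)
    (fun p => paraboloid L m y p.1 + eta)).
    by apply: (@continuous_comp _ _ _ snd
      (fun r => K * (1 + (r - t0) `^ (- b)) * 1) (z, s)); [exact: cvg_snd|exact: cs].
  apply: (@continuousD _ _ _ (fun p => paraboloid L m y p.1) (cst eta)); last exact: cst_continuous.
  by apply: (@continuous_comp _ _ _ fst (paraboloid L m y) (z, s));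
    [exact: cvg_fst|exact: continuous_paraboloid].
have cw : {within closure Omega `*` `[s0, t],
    continuous (fun p : 'rV[R]_N * R => u p.1 p.2 - v p)}.
  move=> p; apply: continuousB; last exact: cv.
  exact: (continuous_subspaceW (cyl s0 (ltW t0s0)) cu).
have [[z s] /set_mem [/= clz] + wmax] := compact_EVT_max (D0 s0 s0t) (cptD s0) cw.
rewrite in_itv /= => /andP[s0s st].
have ts : t0 < s by exact: lt_le_trans s0s.
suff wM : u z s - v (z, s) <= M.
  have xt : (x, t) \in closure Omega `*` `[s0, t].
    apply/mem_set; split => /=; first exact: subset_closure.
    by rewrite in_itv /= s0t lexx.
  by have := wmax _ xt; rewrite {1}/v /=; lra.
rewrite leNgt; apply/negP => Mw.
have prof0 r : 0 < K * (1 + (r - t0) `^ (- b)).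
  by rewrite mulr_gt0 // ltr_wpDr // powR_ge0.
have Phi0 z' : closure Omega z' -> 0 < paraboloid L m y z' + eta.
  by move=> ?; rewrite ltr_wpDl // phi0.
have v0 : 0 < v (z, s) by rewrite mulr_gt0 ?prof0 ?Phi0.
have Oz : Omega z.
  have [iz|niz] := pselect (interior Omega z); first exact: interior_subset.
  have := uM z s (conj clz niz) (Tint s _); rewrite (ltW ts) st => /(_ isT).
  by lra.
have s0lt : s0 < s.
  rewrite lt_neqAle s0s andbT; apply/eqP => ss0.
  have : u z s <= u zU sU.
    apply: (HU (z, s)); apply/mem_set; split => //=.
    by rewrite in_itv /= (ltW ts) st.
  have : K * (1 + tau `^ (- b)) * eta <= v (z, s).
    have -> : tau = s - t0 by rewrite -ss0 /s0; ring.
    by rewrite /v /= ler_wpM2l ?(ltW (prof0 _)) // lerDr phi0.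
  by lra.
set A := K * (1 + (s - t0) `^ (- b)).
pose p i := A * (2 * L * (z 0 i - y 0 i) + m i).
pose Phi := paraboloid L m y z + eta.
pose D := K * (- b * (s - t0) `^ (- b - 1)) * Phi.
have A0 : 0 < A by exact: prof0.
have Dle : D <= dt u z s.
  have [_ [C1t _] _ _] := uC.
  have Ds : is_derive s 1 (u z) (dt u z s).
    rewrite /dt derive1E; apply: derivableP; apply: C1t; split => //=.
    by apply: Tint; rewrite (ltW ts).
  have Dv := @is_derive_barrier_profile _ K b t0 s Phi ts.
  rewrite -subr_ge0.
  apply: (@derive_ge0_at_left_max _ (fun r => u z r -
    K * (1 + (r - t0) `^ (- b)) * Phi) s _ (s - s0)); first by rewrite subr_gt0.
  move=> r; rewrite opprB addrC subrK => /andP[s0r rs].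
  apply: (wmax (z, r)); apply/mem_set; split => //=.
  by rewrite in_itv /= (ltW s0r) (le_trans rs).
have [e e0 He] := open_coordinate_segment oO Oz.
have touch := @touching_inequality _ _ _ q T u z s p (A * L) e D oO uC HJ _ e0 _ Dle.
have : D - N%:R * (2 * (A * L)) + Num.sqrt (\sum_i p i ^+ 2) `^ q <= 0.
  apply: touch.
    by split => //=; apply: Tint; rewrite (ltW ts).
  move=> i h he.
  have hD : (h *: basis_vec i + z, s) \in closure Omega `*` `[s0, t].
    apply/mem_set; split => /=; first exact: subset_closure (He i h he).
    by rewrite in_itv /= s0s st.
  have := wmax _ hD; rewrite /v /= -/A paraboloid_shift /p.
  set X := u _ s; lra.
suff : 0 < D - N%:R * (2 * (A * L)) + Num.sqrt (\sum_i p i ^+ 2) `^ q by lra.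
apply: (@barrier_strict_supersolution _ q K P N%:R L (s - t0) Phi) => //.
- by rewrite subr_gt0.
- lra.
- by rewrite (ltW (Phi0 _ clz)) phiP.
rewrite -/b -/A -(ger0_norm (ltW A0)) -sqrtr_sqr ler_wsqrtr //.
have -> : \sum_i p i ^+ 2 = A ^+ 2 * (4 * L * paraboloid L m y z + \sum_k m k ^+ 2).
  by rewrite -paraboloid_gradient_sqr mulr_sumr; apply: eq_bigr => i _; rewrite exprMn.
rewrite -[leLHS]mulr1 ler_wpM2l ?sqr_ge0 //.
by rewrite -[leLHS]add0r lerD // mulr_ge0 ?phi0 //; lra.
Qed.

(** * The boundary estimate *)

Lemma bounded_coordinate_diff (R : realType) (N : nat) (Omega : set 'rV[R]_N) :
  bounded_set Omega ->
  exists2 rho, 0 < rho & forall x y, closure Omega x -> closure Omega y ->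
    forall k, `|x 0 k - y 0 k| <= rho.
Proof.
move=> /compact_closure_bounded/compact_bounded[B [_ HB]].
pose r := Num.max B 0 + 1.
have r0 : 0 < r by rewrite ltr_wpDl // le_max lexx orbT.
have Br : B < r by rewrite ltr_pwDr // le_max lexx.
have coord (x : 'rV[R]_N) k : closure Omega x -> `|x 0 k| <= r.
  move=> /(HB _ Br) /=; apply: le_trans.
  by rewrite [leRHS]/Num.Def.normr /= mx_normrE; apply/bigmax_geP; right; exists (0, k).
exists (r + r); first by rewrite addr_gt0.
by move=> x y clx cly k; apply: le_trans (ler_normB _ _) _; rewrite lerD ?coord.
Qed.

(** The constant is fixed before u, T and M: it involves the uniform opening
    L, the diameter of Omega, N and q only. *)
Lemma bound_by_distance_to_point (R : realType) (N : nat) (hN : (0 < N)%N)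
    (Omega : set 'rV[R]_N) (hOmega : smooth_bounded_domain Omega)
    (q : R) (hq : 1 < q) :
  exists2 C, 0 < C & forall (T : \bar R) (u : 'rV[R]_N -> R -> R) (M : R),
    continuous_on (cylinder (closure Omega) T) u ->
    class_C21 (cylinder Omega T) u -> HJ_solution q (cylinder Omega T) u ->
    (forall z s, boundary Omega z -> time_interval T s -> u z s <= M) ->
    forall t x y, time_interval T t -> Omega x -> boundary Omega y ->
      u x t <= M + C * (1 + t `^ (- (1 / (q - 1)))) * enorm (x - y).
Proof.
have [oO _ _ bO sO] := hOmega.
have [L L1 HL] := uniform_supporting_paraboloid oO bO sO.
have [rho rho0 Hrho] := bounded_coordinate_diff bO.
have N0 : 0 < N%:R :> R by rewrite ltr0n.
have L0 : 0 < L by lra.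
have q10 : 0 < q - 1 by lra.
set b := 1 / (q - 1); have b0 : 0 < b by rewrite divr_gt0.
pose C1 := N%:R * (L * (rho + 1)).
have C10 : 0 < C1 by rewrite !mulr_gt0 // addr_gt0.
pose P := C1 * (N%:R * rho) + 1.
have P0 : 0 < P by rewrite /P addr_gt0 // mulr_gt0 // mulr_gt0.
pose Z := b * P + N%:R * (2 * L) + 1.
have bP0 : 0 < b * P by exact: mulr_gt0.
have NL0 : 0 < N%:R * (2 * L) by rewrite mulr_gt0 // mulr_gt0.
have Z0 : 0 < Z by rewrite /Z; lra.
(* K^(q-1) = Z, one more than what the strict inequality asks for. *)
pose K := Z `^ b.
have K0 : 0 < K by exact: powR_gt0.
have HK : b * P + N%:R * (2 * L) < K `^ (q - 1).
  rewrite /K -powRrM /b divfK ?gt_eqF // powRr1 ?ltW //.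
  by rewrite /Z ltrDl.
exists (K * 2 `^ b * C1); first by rewrite mulr_gt0 // mulr_gt0 // powR_gt0.
move=> T u M cu uC HJ uM t x y Tt Ox By.
have [m [mL m1 phi0O]] := HL y By.
have phi0 z : closure Omega z -> 0 <= paraboloid L m y z.
  move=> clz; have cl : closed [set z | 0 <= paraboloid L m y z].
    apply: (@preimage_closed _ _ (paraboloid L m y) [set r | 0 <= r]).
      by move=> ? _; exact: continuous_paraboloid.
    exact: closed_ge.
  by move: (closureS phi0O clz); rewrite -((closure_id _).1 cl).
have phile z : closure Omega z -> paraboloid L m y z <= C1 * enorm (z - y).
  move=> clz; apply: paraboloid_le; rewrite ?(ltW L0) // => k.
  by apply: Hrho => //; case: By.
have phiP eta z : eta <= 1 -> Omega z -> paraboloid L m y z + eta <= P.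
  move=> eta1 Oz; have clz : closure Omega z by exact: subset_closure.
  rewrite lerD //; apply: le_trans (phile _ clz) _; rewrite ler_pM2l //.
  apply: enorm_le_box; first exact: ltW.
  by move=> j; rewrite !mxE; apply: Hrho => //; case: By.
have [t0 _] := Tt.
have t2 : 0 < t / 2 by rewrite divr_gt0.
pose F := K * (1 + (t / 2) `^ (- b)).
have F0 : 0 < F by rewrite mulr_gt0 // ltr_wpDr // powR_ge0.
(* The barrier started at t/2; eta <= e / F keeps its shift below e. *)
have limit : u x t <= M + F * paraboloid L m y x.
  apply/ler_addgt0Pr => e e0; pose eta := Num.min 1 (e / F).
  have eta0 : 0 < eta by rewrite lt_min ltr01 divr_gt0.
  have eta1 : eta <= 1 by rewrite ge_min lexx.
  have t2t : t / 2 < t by lra.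
  have := @barrier_comparison _ _ Omega q T u M L K P (t / 2) t eta m y hq oO bO
    cu uC HJ uM L1 m1 phi0 (fun z => phiP eta z eta1) eta0 K0 HK t2 t2t Tt x Ox.
  have -> : t - t / 2 = t / 2 by field.
  rewrite -/b -/F mulrDr addrA => /le_trans; apply; rewrite lerD2l.
  by rewrite mulrC -ler_pdivlMr // ge_min lexx orbT.
apply: le_trans limit _; rewrite lerD2l.
have FC : F <= K * 2 `^ b * (1 + t `^ (- b)).
  rewrite /F -mulrA ler_pM2l // mulrDr mulr1.
  have -> : (t / 2) `^ (- b) = 2 `^ b * t `^ (- b).
    by rewrite powRM ?invr_ge0 ?(ltW t0) // -powR_inv1 // -powRrM mulrNN mul1r mulrC.
  have : (2 : R) `^ 0 <= 2 `^ b by rewrite ler_powR ?ler1n ?(ltW b0).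
  by rewrite powRr0 lerD2r.
have clx : closure Omega x by exact: subset_closure.
apply: (@le_trans _ _ (F * (C1 * enorm (x - y)))); first by rewrite ler_pM2l ?phile.
have -> : K * 2 `^ b * C1 * (1 + t `^ (- b)) * enorm (x - y) =
  K * 2 `^ b * (1 + t `^ (- b)) * (C1 * enorm (x - y)) by ring.
by rewrite ler_wpM2r // mulr_ge0 ?(ltW C10) // sqrtr_ge0.
Qed.

Unset Implicit Arguments.

Theorem lemma2p11 (R : realType) (N : nat) (hN : (1 <= N)%N)
    (Omega : set 'rV[R]_N) (hOmega : smooth_bounded_domain Omega)
    (q : R) (hq : 1 < q) :
  exists C : R,
    forall (T : \bar R) (hT : (0 < T)%E) (u : 'rV[R]_N -> R -> R),
      continuous_on (cylinder (closure Omega) T) u ->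
      class_C21 (cylinder Omega T) u ->
      (forall x t, cylinder (closure Omega) T (x, t) -> 0 <= u x t) ->
      HJ_solution q (cylinder Omega T) u ->
      [bounded u p.1 p.2 | p in cylinder (boundary Omega) T] ->
      forall t x, time_interval T t -> Omega x ->
        u x t <= C * (1 + t `^ (- (1 / (q - 1)))) * dist_to x (boundary Omega)
                 + sup [set u p.1 p.2 | p in cylinder (boundary Omega) T].
Proof.
have [C C0 HC] := bound_by_distance_to_point hN hOmega hq.
have [_ _ O0 bO _] := hOmega.
have B0 : boundary Omega !=set0 by exact: boundary_nonempty.
exists C => T hT u cu uC _ HJ bu t x Tt Ox.
set M := sup _; set c := C * _.
have c0 : 0 < c by rewrite mulr_gt0 // ltr_wpDr // powR_ge0.
have uM z s : boundary Omega z -> time_interval T s -> u z s <= M.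
  move=> Bz Ts; apply: ub_le_sup; last by exists (z, s).
  have [B [_ HB]] := bu; exists (B + 1) => _ [p Qp <-].
  have B1 : B < B + 1 by rewrite ltrDl.
  by apply: le_trans (ler_norm _) _; exact: (HB _ B1 p Qp).
rewrite -lerBlDr mulrC -ler_pdivrMr //.
apply: lb_le_inf; first by case: B0 => y By; exists (enorm (x - y)), y.
move=> _ [y By <-]; rewrite ler_pdivrMr // lerBlDl mulrC.
exact: (HC T u M).
Qed.
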